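(* Let $G$ be a finitely generated group and let $\mathcal{P}$ be a finite qi-characteristic collection of subgroups of $G$. If $H$ is a finitely generated group and $q\colon G\to H$ is a quasi-isometry, then there is a qi-characteristic collection of subgroups $\mathcal{Q}$ of $H$ such that $q\colon (G,\mathcal{P})\to (H,\mathcal{Q})$ is a quasi-isometry of pairs.
   Context: Finitely generated groups are equipped with a chosen word metric $\mathsf{dist}_G$ (with respect to a finite generating set, left-invariant); $\mathsf{hdist}_G$ denotes the Hausdorff distance (possibly infinite) between subsets of $G$. For a collection $\mathcal{P}$ of subgroups of $G$, $G/\mathcal{P}$ denotes the set of left cosets $gP$ with $g\in G$, $P\in\mathcal{P}$. A map $q\colon X\to Y$ of metric spaces is $(L,C)$-coarse Lipschitz if $\mathsf{dist}(q(x),q(y))\le L\,\mathsf{dist}(x,y)+C$ for all $x,y$. It is an $(L,C)$-quasi-isometry if it is $(L,C)$-coarse Lipschitz and there is an $(L,C)$-coarse Lipschitz map $\bar q\colon Y\to X$ with $\mathsf{dist}(\bar q q(x),x)\le C$ and $\mathsf{dist}(q\bar q(y),y)\le C$ for all $x\in X$, $y\in Y$. It is a quasi-isometry if it is an $(L,C)$-quasi-isometry for some $L\ge 1$, $C\ge 0$. Let $\mathcal{P}$, $\mathcal{Q}$ be collections of subgroups of $G$, $H$. An $(L,C)$-quasi-isometry $q\colon G\to H$ is an $(L,C,M)$-quasi-isometry of pairs $q\colon(G,\mathcal{P})\to(H,\mathcal{Q})$ if for every $A\in G/\mathcal{P}$ there is $B\in H/\mathcal{Q}$ with $\mathsf{hdist}_H(q(A),B)<M$,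 and for every $B\in H/\mathcal{Q}$ there is $A\in G/\mathcal{P}$ with $\mathsf{hdist}_H(q(A),B)<M$. It is a quasi-isometry of pairs if this holds for some $M>0$. The commensurator of $P\le G$ is $Comm_G(P)=\{g\in G : P\cap gPg^{-1}$ has finite index in both $P$ and $gPg^{-1}\}$. A collection $\mathcal{P}$ of subgroups of $G$ is qi-characteristic if $\mathcal{P}$ is finite, each $P\in\mathcal{P}$ has finite index in its commensurator, and for all $L\ge1$, $C\ge0$ there is $M=M(L,C)>0$ such that every $(L,C)$-quasi-isometry $q\colon G\to G$ is an $(L,C,M)$-quasi-isometry of pairs $q\colon(G,\mathcal{P})\to(G,\mathcal{P})$. *)

(* Defs.v *)
From mathcomp Require Import all_boot all_order all_algebra.
From mathcomp Require Import all_classical all_reals ereal.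

Set Implicit Arguments.
Unset Strict Implicit.
Unset Printing Implicit Defensive.

Import Order.TTheory GRing.Theory Num.Theory.
Local Open Scope classical_set_scope.
Local Open Scope ring_scope.

Section Groups.
Variable G : groupType.
Implicit Types (S A K P : set G) (PP : set (set G)).

Definition subgroup A : Prop := group_closed [in A].

Definition is_word_over S (w : seq G) : Prop :=
  forall s, s \in w -> S s \/ S (s^-1)%g.

Definition generates S : Prop :=
  forall g : G, exists w : seq G, is_word_over S w /\ (\prod_(s <- w) s)%g = g.

Definition lcoset_set (g : G) A : set G := [set (g * x)%g | x in A].

(* [conj_set g A] is $g A g^{-1}$; MathComp's [x ^ g] is $g^{-1} x g$. *)
Definition conj_set (g : G) A : set G := [set (g * x * g^-1)%g | x in A].

Definition lcosets_of PP : set (set G) :=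
  [set A | exists g P, PP P /\ A = lcoset_set g P].

Definition finite_index K A : Prop :=
  K `<=` A /\ finite_set [set lcoset_set a K | a in A].

Definition commensurator P : set G :=
  [set g | finite_index (P `&` conj_set g P) P /\
           finite_index (P `&` conj_set g P) (conj_set g P)].

End Groups.

Section WordMetric.
Variables (R : realType) (G : groupType).

(* When [S] generates [G] this is the least length of a word representing
   [g]: the infimum is over a nonempty set of natural numbers. *)
Definition word_norm (S : set G) (g : G) : R :=
  inf [set (size w)%:R | w in
    [set w : seq G | is_word_over S w /\ (\prod_(s <- w) s)%g = g]].

Definition word_dist (S : set G) (x y : G) : R := word_norm S (x^-1 * y)%g.

End WordMetric.

(* The infimum of the empty set in [\bar R] is [+oo]. *)
Definition hausdorff_dist (R : realType) (X : Type) (d : X -> X -> R)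
    (A B : set X) : \bar R :=
  ereal_inf [set r%:E | r in [set r : R | 0 <= r /\
    (forall a, A a -> exists b, B b /\ d a b <= r) /\
    (forall b, B b -> exists a, A a /\ d a b <= r)]].

Section QuasiIsometries.
Variables (R : realType) (X Y : Type) (dX : X -> X -> R) (dY : Y -> Y -> R).

Definition coarse_lipschitz (L C : R) (q : X -> Y) : Prop :=
  forall x x', dY (q x) (q x') <= L * dX x x' + C.

End QuasiIsometries.

Definition quasi_isometry_LC (R : realType) (X Y : Type)
    (dX : X -> X -> R) (dY : Y -> Y -> R) (L C : R) (q : X -> Y) : Prop :=
  coarse_lipschitz dX dY L C q /\
  exists qbar : Y -> X,
    [/\ coarse_lipschitz dY dX L C qbar,
        forall x, dX (qbar (q x)) x <= C &
        forall y, dY (q (qbar y)) y <= C].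

Definition quasi_isometry (R : realType) (X Y : Type)
    (dX : X -> X -> R) (dY : Y -> Y -> R) (q : X -> Y) : Prop :=
  exists L C : R, [/\ 1 <= L, 0 <= C & quasi_isometry_LC dX dY L C q].

Section Pairs.
Variables (R : realType) (G H : groupType).
Variables (dG : G -> G -> R) (dH : H -> H -> R).
Variables (PP : set (set G)) (QQ : set (set H)).

Definition quasi_isometry_pairs_LCM (L C M : R) (q : G -> H) : Prop :=
  [/\ quasi_isometry_LC dG dH L C q,
      forall A, lcosets_of PP A -> exists B, lcosets_of QQ B /\
        (hausdorff_dist dH (q @` A) B < M%:E)%E &
      forall B, lcosets_of QQ B -> exists A, lcosets_of PP A /\
        (hausdorff_dist dH (q @` A) B < M%:E)%E].

Definition quasi_isometry_pairs (q : G -> H) : Prop :=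
  exists L C M : R,
    [/\ 1 <= L, 0 <= C, 0 < M & quasi_isometry_pairs_LCM L C M q].

End Pairs.

Definition qi_characteristic (R : realType) (G : groupType)
    (dG : G -> G -> R) (PP : set (set G)) : Prop :=
  [/\ finite_set PP,
      forall P, PP P -> finite_index P (commensurator P) &
      forall L C : R, 1 <= L -> 0 <= C -> exists M : R, 0 < M /\
        forall q : G -> G, quasi_isometry_LC dG dG L C q ->
          quasi_isometry_pairs_LCM dG dG PP PP L C M q].

(* Main.v *)
Require Import Defs.
From mathcomp Require Import all_boot all_order all_algebra.
From mathcomp Require Import all_classical all_reals ereal.
From mathcomp Require Import lra.

Set Implicit Arguments.
Unset Strict Implicit.
Unset Printing Implicit Defensive.

Import Order.TTheory GRing.Theory Num.Theory.
Local Open Scope classical_set_scope.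
Local Open Scope ring_scope.

(** The images [q A], for [A] a left coset of a member of [PP], form a family
    [XX] of subsets of [H] which every quasi-isometry of [H] permutes up to
    bounded error, since it is conjugated by [q] to a quasi-isometry of [G]; in
    particular left translations do so with a uniform error.  Finite index in
    the commensurator says that members of [XX] at finite Hausdorff distance
    are at uniformly bounded distance, and [XX] is locally finite.  Hence the
    coarse stabilizer of [X \in XX], i.e. the subgroup of all [h] with [h X] at
    finite Hausdorff distance from [X], lies at finite distance from [X], so it
    is its own commensurator.  Up to translation and bounded error every member
    of [XX] is one of the finitely many which meet a fixed ball around [1], and
    the coarse stabilizers of these form the required collection. *)

(** By monotonicity the maximum of the finitely many individual bounds works; uniform constants over
    finite families are obtained this way throughout. *)
Lemma finite_uniform_bound (R : realType) (T : Type) (E : set T)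
    (Phi : T -> R -> Prop) : finite_set E ->
  (forall x r s, r <= s -> Phi x r -> Phi x s) ->
  (forall x, E x -> exists r, Phi x r) ->
  exists r, forall x, E x -> Phi x r.
Proof.
(* Classically [T] carries a choice structure, hence decidable equality, so that membership in a
   sequence makes sense. *)
elim/Pchoice: T => T in E Phi *.
move=> /finite_seqP[s ->{E}] mono; elim: s => [|x s IHs] ex_r.
  by exists 0.
have [x' /= xs'|r rP] := IHs; first by apply: ex_r; rewrite /= inE xs' orbT.
have [|r0 r0P] := ex_r x; first by rewrite /= inE eqxx.
exists (Num.max r0 r) => y /=; rewrite inE => /orP[/eqP->|ys].
  by apply: mono r0P; rewrite le_max lexx.
by apply: mono (rP _ ys); rewrite le_max lexx orbT.
Qed.

(** * Subgroups, conjugates and left cosets *)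

Section Cosets.
Variable G : groupType.
Implicit Types (g h x y : G) (A K P : set G).

Lemma subgroupP A :
  subgroup A <-> A 1%g /\ forall x y, A x -> A y -> A (x * y^-1)%g.
Proof.
split=> -[A1 AB]; split; rewrite ?inE // in A1 *.
  by move=> x y Ax Ay; have := AB x y; rewrite !inE; exact.
by move=> x y; rewrite !inE; exact: AB.
Qed.

Lemma subgroup1 A : subgroup A -> A 1%g.
Proof. by move=> /subgroupP[]. Qed.

Lemma subgroupV A x : subgroup A -> A x -> A x^-1%g.
Proof. by move=> /subgroupP[A1 AB] Ax; rewrite -[_^-1%g]mul1g; exact: AB. Qed.

Lemma subgroupM A x y : subgroup A -> A x -> A y -> A (x * y)%g.
Proof.
move=> sA Ax /(subgroupV sA) Ay; rewrite -[y]invgK.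
by case/subgroupP: sA => _; exact.
Qed.

Lemma subgroupI A K : subgroup A -> subgroup K -> subgroup (A `&` K).
Proof.
move=> /subgroupP[A1 AB] /subgroupP[K1 KB]; apply/subgroupP; split=> //.
by move=> x y [Ax Kx] [Ay Ky]; split; [exact: AB|exact: KB].
Qed.

Lemma subgroup_conj g P : subgroup P -> subgroup (conj_set g P).
Proof.
move=> /subgroupP[P1 PB]; apply/subgroupP; split.
  by exists 1%g => //; rewrite mulg1 mulgV.
move=> _ _ [x Px <-] [y Py <-]; exists (x * y^-1)%g; first exact: PB.
by rewrite !invgM invgK !mulgA mulgVK.
Qed.

Lemma conj_set_id g P : subgroup P -> P g -> conj_set g P = P.
Proof.
move=> sP Pg; apply/seteqP; split=> [_ [x Px <-]|x Px].
  by apply: subgroupM => //; [exact: subgroupM|exact: subgroupV].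
exists (g^-1 * x * g)%g; last by rewrite !mulgA mulgV mul1g mulgK.
by apply: subgroupM => //; apply: subgroupM => //; exact: subgroupV.
Qed.

Lemma lcoset_setM g h A : lcoset_set g (lcoset_set h A) = lcoset_set (g * h)%g A.
Proof.
apply/seteqP; split=> [_ [_ [x Ax <-] <-]|_ [x Ax <-]].
  by exists x => //; rewrite mulgA.
by exists (h * x)%g; [exists x|rewrite mulgA].
Qed.

Lemma lcoset_set1 A : lcoset_set 1%g A = A.
Proof.
apply/seteqP; split=> [_ [x Ax <-]|x Ax]; first by rewrite mul1g.
by exists x => //; rewrite mul1g.
Qed.

Lemma lcoset_set_id x P : subgroup P -> P x -> lcoset_set x P = P.
Proof.
move=> sP Px; apply/seteqP; split=> [_ [y Py <-]|y Py]; first exact: subgroupM.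
exists (x^-1 * y)%g; last by rewrite mulVKg.
by apply: subgroupM => //; exact: subgroupV.
Qed.

Lemma lcosets_of_nonempty PP A :
  (forall P, PP P -> subgroup P) -> lcosets_of PP A -> A !=set0.
Proof.
move=> subPP [g [P [PPP ->]]]; exists (g * 1)%g; exists 1%g => //.
exact: subgroup1 (subPP _ PPP).
Qed.

Lemma sub_commensurator P : subgroup P -> P `<=` commensurator P.
Proof.
move=> sP g Pg; rewrite /commensurator /= conj_set_id // setIid.
suff fin : finite_index P P by split.
split=> //; apply: (sub_finite_set _ (finite_set1 P)) => _ [x Px <-].
by rewrite lcoset_set_id.
Qed.

End Cosets.

(** * Hausdorff closeness of subsets *)

(** A version of bounded Hausdorff distance free of infima and of any sign condition on [r], so that
    constants can simply be added. *)
Definition hclose (R : realType) (X : Type) (d : X -> X -> R) (r : R)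
    (A B : set X) : Prop :=
  (forall a, A a -> exists b, B b /\ d a b <= r) /\
  (forall b, B b -> exists a, A a /\ d a b <= r).

Lemma hclose_of_hausdorff (R : realType) (X : Type) (d : X -> X -> R) r A B :
  (hausdorff_dist d A B < r%:E)%E -> hclose d r A B.
Proof.
move=> /ereal_inf_lt[_ [s [_ [AB BA]] <-]]; rewrite lte_fin => /ltW sr.
split=> [a /AB|b /BA] [c [? /le_trans cs]]; by exists c; split=> //; exact: cs.
Qed.

Lemma hclose_le (R : realType) (X : Type) (d : X -> X -> R) r s A B :
  r <= s -> hclose d r A B -> hclose d s A B.
Proof.
move=> rs [AB BA]; split=> [x /AB|x /BA] [y [By xy]];
  by exists y; split=> //; exact: le_trans rs.
Qed.

(** The maximum with 0 meets the sign condition in [hausdorff_dist], and the added 1 makes the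
    inequality strict. *)
Lemma hausdorff_of_hclose (R : realType) (X : Type) (d : X -> X -> R) r A B :
  hclose d r A B -> (hausdorff_dist d A B < (Num.max 0 r + 1)%:E)%E.
Proof.
move=> AB; apply: (@le_lt_trans _ _ (Num.max 0 r)%:E); last first.
  by rewrite lte_fin ltrDl.
apply: ereal_inf_lbound; exists (Num.max 0 r) => //; split; first by rewrite le_max lexx.
by apply: hclose_le AB; rewrite le_max lexx orbT.
Qed.

Lemma hclose_image (R : realType) (X Y : Type) (dX : X -> X -> R)
    (dY : Y -> Y -> R) (L C r : R) (f : X -> Y) A B :
  0 <= L -> coarse_lipschitz dX dY L C f ->
  hclose dX r A B -> hclose dY (L * r + C) (f @` A) (f @` B).
Proof.
move=> L0 lipf [AB BA]; split=> [_ [x /AB[y [By xy]] <-]|_ [x /BA[y [By xy]] <-]];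
  exists (f y); split; try (by exists y);
  by apply: le_trans (lipf _ _) _; rewrite lerD2r ler_wpM2l.
Qed.

(** * Word metrics as proper left-invariant metrics *)

Record proper_left_metric (R : realType) (G : groupType) (d : G -> G -> R) :
    Prop := ProperLeftMetric {
  dist_refl : forall x, d x x = 0;
  dist_sym : forall x y, d x y = d y x;
  dist_tri : forall y x z, d x z <= d x y + d y z;
  dist_mulg : forall g x y, d (g * x)%g (g * y)%g = d x y;
  finite_ball1 : forall r, finite_set [set x | d 1%g x <= r]
}.

Section WordMetricProper.
Variables (R : realType) (G : groupType) (S : set G).
Hypotheses (finS : finite_set S) (genS : generates S).

(** Word lengths are natural numbers, so a shortest word exists and realizes the infimum. *)
Lemma word_norm_attained (g : G) : exists w : seq G,
  [/\ is_word_over S w, (\prod_(s <- w) s)%g = g & word_norm R S g = (size w)%:R].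
Proof.
pose P n := `[< exists w : seq G,
  [/\ is_word_over S w, (\prod_(s <- w) s)%g = g & size w = n] >].
have [|n /asboolP[w [Sw wg <-]] minw] := @ex_minnP P.
  by have [w [? ?]] := genS g; exists (size w); apply/asboolP; exists w.
exists w; split=> //; apply/eqP; rewrite eq_le; apply/andP; split.
  apply: ge_inf; last by exists w.
  by exists 0 => _ [v _ <-]; rewrite ler0n.
apply: lb_le_inf; first by exists (size w)%:R; exists w.
move=> _ [v [Sv vg] <-]; rewrite ler_nat; apply: minw.
by apply/asboolP; exists v.
Qed.

Lemma word_norm_le (w : seq G) : is_word_over S w ->
  word_norm R S (\prod_(s <- w) s)%g <= (size w)%:R.
Proof.
move=> Sw; apply: ge_inf; last by exists w.
by exists 0 => _ [v _ <-]; rewrite ler0n.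
Qed.

Lemma word_normM (x y : G) :
  word_norm R S (x * y)%g <= word_norm R S x + word_norm R S y.
Proof.
have [v [Sv <- ->]] := word_norm_attained x.
have [w [Sw <- ->]] := word_norm_attained y.
rewrite -big_cat -natrD -size_cat; apply: word_norm_le => s.
by rewrite mem_cat => /orP[/Sv|/Sw].
Qed.

(** Reversing a word and inverting its letters represents the inverse at the same length. *)
Lemma word_normV_le (x : G) : word_norm R S x^-1%g <= word_norm R S x.
Proof.
have [v [Sv <- ->]] := word_norm_attained x.
rewrite -[v in (_ v _)^-1%g]revK -prodgV -(size_rev v) -(size_map (@monoid.inv G)).
rewrite -(big_map (@monoid.inv G) xpredT id) /=; apply: word_norm_le => s.
by move=> /mapP[t]; rewrite mem_rev => /Sv[] ? ->; [right|left]; rewrite ?invgK.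
Qed.

Lemma finite_words (n : nat) : finite_set
  [set (\prod_(s <- w) s)%g | w in [set w : seq G | is_word_over S w /\ size w = n]].
Proof.
elim: n => [|n IHn].
  apply: (sub_finite_set _ (finite_set1 1%g)) => _ [w [_ /size0nil ->] <-].
  by rewrite big_nil.
have finU : finite_set (S `|` [set x^-1%g | x in S]).
  by rewrite finite_setU; split=> //; exact: finite_image.
apply: (sub_finite_set _ (finite_image2 (fun x y : G => x * y)%g finU IHn)).
move=> _ [[|s w] [Sw] //= [sw] <-]; rewrite big_cons; exists s => /=.
  have [|Ss|Ss] := Sw s; first by rewrite inE eqxx.
    by left.
  by right; exists s^-1%g; rewrite ?invgK.
exists (\prod_(s <- w) s)%g => //; exists w => //; split=> // t tw.
by apply: Sw; rewrite inE tw orbT.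
Qed.

Lemma word_dist_proper : proper_left_metric (word_dist R S).
Proof.
split; rewrite /word_dist.
- move=> x; rewrite mulVg; apply/eqP; rewrite eq_le; apply/andP; split.
    have := @word_norm_le [::]; rewrite big_nil; apply=> s; by rewrite in_nil.
  by have [w [_ _ ->]] := word_norm_attained 1%g; rewrite ler0n.
- move=> x y; have xyE : (x^-1 * y)^-1%g = (y^-1 * x)%g by rewrite invgM invgK.
  apply/eqP; rewrite eq_le -{2}xyE word_normV_le andbT.
  by rewrite -[(x^-1 * y)%g]invgK xyE word_normV_le.
- move=> y x z; apply: le_trans (word_normM _ _).
  by rewrite mulgA mulgK.
- by move=> g x y; rewrite invgM mulgA mulgVK.
- move=> r.
  (* Elements of the ball have words of length at most the integer part of [r]; the successor turns
     this into a strict bound on [n]. *)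
  apply: (@sub_finite_set _ _ (\bigcup_(n in `I_(Num.truncn r).+1)
    [set (\prod_(s <- w) s)%g |
       w in [set w : seq G | is_word_over S w /\ size w = n]])); last first.
    by apply: bigcup_finite => // n _; exact: finite_words.
  move=> x /=; rewrite invg1 mul1g.
  have [w [Sw wx ->]] := word_norm_attained x => wr.
  exists (size w) => /=; last by exists w.
  by rewrite ltnS truncn_ge_nat // (le_trans _ wr) // ler0n.
Qed.

End WordMetricProper.

(** * Finite Hausdorff distance, finite index and commensurators *)

Definition finite_dist (R : realType) (X : Type) (d : X -> X -> R)
    (A B : set X) : Prop := exists r, hclose d r A B.

Section Closeness.
Variables (R : realType) (G : groupType) (d : G -> G -> R).
Hypothesis dP : proper_left_metric d.
Implicit Types (g h x y : G) (A B K P : set G) (r s : R).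

Lemma hclose_refl A : hclose d 0 A A.
Proof. by split=> a Aa; exists a; rewrite (dist_refl dP). Qed.

Lemma hclose_sym r A B : hclose d r A B -> hclose d r B A.
Proof.
by move=> [AB BA]; split=> [x /BA|x /AB] [y [? ?]]; exists y; rewrite (dist_sym dP).
Qed.

Lemma hclose_trans r s B A K :
  hclose d r A B -> hclose d s B K -> hclose d (r + s) A K.
Proof.
move=> [AB BA] [BK KB]; split.
  move=> x /AB[y [/BK[z [Kz yz]] xy]]; exists z; split=> //.
  exact: le_trans (dist_tri dP y _ _) (lerD xy yz).
move=> x /KB[y [/BA[z [Az zy]] yx]]; exists z; split=> //.
exact: le_trans (dist_tri dP y _ _) (lerD zy yx).
Qed.

Lemma hclose_pointwise (T : Type) r (f f' : T -> G) (E : set T) :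
  (forall t, E t -> d (f t) (f' t) <= r) -> hclose d r (f @` E) (f' @` E).
Proof.
move=> ff'; split=> _ [t Et <-]; [exists (f' t)|exists (f t)];
  by split; [exists t|exact: ff'].
Qed.

Lemma hclose_displacement r (f : G -> G) A :
  (forall x, d (f x) x <= r) -> hclose d r (f @` A) A.
Proof.
by move=> fr; rewrite -{2}[A]image_id; apply: hclose_pointwise => x _; exact: fr.
Qed.

Lemma hclose_lcoset g r A B :
  hclose d r A B -> hclose d r (lcoset_set g A) (lcoset_set g B).
Proof.
move=> [AB BA]; split=> [_ [x /AB[y [By xy]] <-]|_ [x /BA[y [By xy]] <-]];
  by exists (g * y)%g; split; [exists y|rewrite (dist_mulg dP)].
Qed.

Lemma finite_dist_sym A B : finite_dist d A B -> finite_dist d B A.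
Proof. by move=> [r /hclose_sym]; exists r. Qed.

Lemma finite_dist_trans B A K :
  finite_dist d A B -> finite_dist d B K -> finite_dist d A K.
Proof. by move=> [r AB] [s /(hclose_trans AB)]; exists (r + s). Qed.

Lemma finite_dist_lcoset g A B :
  finite_dist d A B -> finite_dist d (lcoset_set g A) (lcoset_set g B).
Proof. by move=> [r /(hclose_lcoset g)]; exists r. Qed.

(** Right multiplication by [g^-1] moves every point by the same distance, by left invariance. *)
Lemma finite_dist_conj g P : finite_dist d (conj_set g P) (lcoset_set g P).
Proof.
exists (d g^-1%g 1%g); apply: hclose_pointwise => x _.
by rewrite -(dist_mulg dP (g * x)%g g^-1%g) mulg1.
Qed.

Lemma finite_ball x r : finite_set [set y | d x y <= r].
Proof.
apply: (sub_finite_set _ (finite_image (fun z => x * z)%g (finite_ball1 dP r))).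
move=> y /= xy; exists (x^-1 * y)%g; last by rewrite mulVKg.
by rewrite /= -(dist_mulg dP x) mulg1 mulVKg.
Qed.

(** Every point of a right coset [K a] is within [d 1 a] of [K]. Inversion matches right cosets with
    left cosets, which are finite in number; hence [Phi] is indexed by the left coset of [a^-1]. *)
Lemma finite_index_dist K A :
  subgroup K -> subgroup A -> finite_index K A -> finite_dist d K A.
Proof.
move=> sK sA [KA finKA].
pose Phi (Y : set G) r := forall a, A a -> lcoset_set a^-1%g K = Y ->
  exists k, K k /\ d k a <= r.
have [||r rP] := @finite_uniform_bound R _ _ Phi finKA.
- move=> Y r s rs YP a Aa aY; have [k [Kk ka]] := YP a Aa aY.
  by exists k; split=> //; exact: le_trans rs.
- move=> _ [b Ab <-]; exists (d 1%g b^-1%g) => a Aa aY.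
  have : lcoset_set b K a^-1%g.
    by rewrite -aY; exists 1%g; [exact: subgroup1|rewrite mulg1].
  move=> [k Kk /(congr1 (@monoid.inv G))]; rewrite invgK invgM => <-.
  exists k^-1%g; split; first exact: subgroupV.
  by rewrite -{1}[(k^-1)%g]mulg1 (dist_mulg dP).
exists (Num.max 0 r); split=> [k Kk|a Aa].
  exists k; split; first exact: KA.
  by rewrite (dist_refl dP) le_max lexx.
have [] := rP (lcoset_set a^-1%g K) _ a Aa erefl.
  by exists a^-1%g => //; exact: subgroupV.
by move=> k [Kk ka]; exists k; split=> //; rewrite le_max ka orbT.
Qed.

(* If [p^-1 = k b] with [k \in K], then the coset [p (P `&` K)] is the set of
   all [x \in P] with [x^-1 \in K b]: it is determined by [b], which ranges over
   a finite ball. *)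
Lemma finite_index_setI K P : subgroup K -> subgroup P ->
  finite_dist d P K -> finite_index (P `&` K) P.
Proof.
move=> sK sP [r [PK _]]; split; first by move=> x [].
pose F b := [set x | P x /\ exists2 k, K k & x^-1%g = (k * b)%g].
apply: (sub_finite_set _ (finite_image F (finite_ball1 dP r))).
move=> _ [p Pp <-]; have [k [Kk]] := PK _ (subgroupV sP Pp).
rewrite (dist_sym dP) -{1}[k]mulg1 => kp.
exists (k^-1 * p^-1)%g; first by rewrite /= -(dist_mulg dP k) mulVKg.
apply/seteqP; split=> [x [Px [k' Kk' xE]]|_ [z [Pz Kz] <-]].
  exists (p^-1 * x)%g; last by rewrite mulVKg.
  split; first by apply: subgroupM => //; exact: subgroupV.
  have -> : (p^-1 * x = k * k'^-1)%g.
    by rewrite -[x]invgK xE !invgM !invgK !mulgA mulVg mul1g.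
  by apply: subgroupM => //; exact: subgroupV.
split; first exact: subgroupM.
exists (z^-1 * k)%g; first by apply: subgroupM => //; exact: subgroupV.
by rewrite invgM -mulgA mulVKg.
Qed.

(** Since [conj_set g P] is at finite distance from [g P], commensurating becomes a metric
    condition: finite index in both groups gives finite distance through the intersection, and
    [finite_index_setI] gives the converse. *)
Lemma commensuratorP P g : subgroup P ->
  commensurator P g <-> finite_dist d (lcoset_set g P) P.
Proof.
move=> sP; have sC := subgroup_conj g sP; split=> [[fP fC]|gP].
  have sI := subgroupI sP sC.
  apply: finite_dist_trans (finite_dist_sym (finite_dist_conj g P)) _.
  apply: finite_dist_trans (finite_index_dist sI sP fP).
  exact/finite_dist_sym/finite_index_dist.
have CP := finite_dist_trans (finite_dist_conj g P) gP.
split; first exact/finite_index_setI/finite_dist_sym.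
by rewrite setIC; exact: finite_index_setI.
Qed.

(* The cosets of [P'] at finite distance from [P] form a single coset of the
   commensurator of [P'], so there are finitely many of them. *)
Lemma finite_dist_bounded PP : finite_set PP ->
  (forall P, PP P -> subgroup P) ->
  (forall P, PP P -> finite_index P (commensurator P)) ->
  exists D, forall A B, lcosets_of PP A -> lcosets_of PP B ->
    finite_dist d A B -> hclose d D A B.
Proof.
move=> finPP subPP commPP.
pose Phi P P' D := forall g, finite_dist d P (lcoset_set g P') ->
  hclose d D P (lcoset_set g P').
have monoPhi P P' r s : r <= s -> Phi P P' r -> Phi P P' s.
  by move=> rs PhiP g /PhiP; exact: hclose_le.
have Phi1 P P' : PP P' -> exists D, Phi P P' D.
  move=> PP'; case: (pselect (exists g, finite_dist d P (lcoset_set g P'))); last first.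
    by move=> none; exists 0 => g Pg; case: none; exists g.
  move=> [g0 Pg0].
  pose Psi Y D := finite_dist d P (lcoset_set g0 Y) -> hclose d D P (lcoset_set g0 Y).
  have [_ fin] := commPP _ PP'.
  have [Y r s rs YP /YP|Y _|D DP] := @finite_uniform_bound R _ _ Psi fin.
  - exact: hclose_le.
  - have [[D DP]|none] := pselect (finite_dist d P (lcoset_set g0 Y)); first by exists D.
    by exists 0.
  exists D => g Pg.
  have := DP (lcoset_set (g0^-1 * g)%g P'); rewrite /Psi lcoset_setM mulVKg.
  apply=> //; exists (g0^-1 * g)%g => //; apply/commensuratorP; first exact: subPP.
  have := finite_dist_trans (finite_dist_sym Pg) Pg0.
  by move=> /(finite_dist_lcoset g0^-1%g); rewrite !lcoset_setM mulVg lcoset_set1.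
have Phi2 P : PP P -> exists D, forall P', PP P' -> Phi P P' D.
  move=> PPP; apply: finite_uniform_bound => // [P' r s|P' PP'].
    exact: monoPhi.
  exact: Phi1.
have [P r s rs PhiP P' /PhiP|//|D DP] := @finite_uniform_bound R _ _
    (fun P D => forall P', PP P' -> Phi P P' D) finPP.
  exact: monoPhi.
(* Translating by [g^-1] makes the first coset a member of [PP], the case covered by [D]. *)
exists D => _ _ [g [P [PPP ->]]] [g' [P' [PP' ->]]] /(finite_dist_lcoset g^-1%g).
rewrite !lcoset_setM mulVg lcoset_set1 => /(DP P PPP P' PP')/(hclose_lcoset g).
by rewrite lcoset_setM mulVKg.
Qed.

End Closeness.

(** * Composition and inversion of quasi-isometries *)

Lemma coarse_lipschitz_comp (R : realType) (X Y Z : Type) (dX : X -> X -> R)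
    (dY : Y -> Y -> R) (dZ : Z -> Z -> R) L1 C1 L2 C2 (f : X -> Y) (g : Y -> Z) :
  0 <= L2 ->
  coarse_lipschitz dX dY L1 C1 f -> coarse_lipschitz dY dZ L2 C2 g ->
  coarse_lipschitz dX dZ (L2 * L1) (L2 * C1 + C2) (g \o f).
Proof.
move=> L20 lf lg x x'; apply: le_trans (lg _ _) _.
by rewrite addrA lerD2r -mulrA -mulrDr ler_wpM2l.
Qed.

Lemma coarse_lipschitz_le (R : realType) (X Y : Type) (dX : X -> X -> R)
    (dY : Y -> Y -> R) L C C' (f : X -> Y) : C <= C' ->
  coarse_lipschitz dX dY L C f -> coarse_lipschitz dX dY L C' f.
Proof. by move=> CC' lf x x'; apply: le_trans (lf _ _) _; rewrite lerD2l. Qed.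

Section QuasiIsometryCalculus.
Variables (R : realType) (G H K : groupType).
Variables (dG : G -> G -> R) (dH : H -> H -> R) (dK : K -> K -> R).
Hypotheses (dGP : proper_left_metric dG) (dHP : proper_left_metric dH)
  (dKP : proper_left_metric dK).

(** The additive constant dominates the four that arise: [L2 * C1 + C2] and [L1 * C2 + C1] for the
    two composites, [L1 * C2 + 2 * C1] and [L2 * C1 + 2 * C2] for the displacements. *)
Lemma quasi_isometry_LC_comp L1 C1 L2 C2 (f : G -> H) (g : H -> K) :
  1 <= L1 -> 0 <= C1 -> 1 <= L2 -> 0 <= C2 ->
  quasi_isometry_LC dG dH L1 C1 f -> quasi_isometry_LC dH dK L2 C2 g ->
  quasi_isometry_LC dG dK (L1 * L2) (L1 * C2 + L2 * C1 + 2 * C1 + 2 * C2) (g \o f).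
Proof.
move=> L11 C10 L21 C20 [lf [f' [lf' f'f ff']]] [lg [g' [lg' g'g gg']]].
have L10 : 0 <= L1 by lra.
have L20 : 0 <= L2 by lra.
have LC1 : 0 <= L2 * C1 by rewrite mulr_ge0.
have LC2 : 0 <= L1 * C2 by rewrite mulr_ge0.
split.
  rewrite mulrC; apply: coarse_lipschitz_le (coarse_lipschitz_comp L20 lf lg).
  lra.
exists (f' \o g'); split.
- apply: (coarse_lipschitz_le _ (coarse_lipschitz_comp L10 lg' lf')); lra.
- move=> x /=; apply: le_trans (dist_tri dGP (f' (f x)) _ _) _.
  apply: le_trans (lerD (lf' _ _) (f'f x)) _.
  have := ler_wpM2l L10 (g'g (f x)); lra.
- move=> z /=; apply: le_trans (dist_tri dKP (g (g' z)) _ _) _.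
  apply: le_trans (lerD (lg _ _) (gg' z)) _.
  have := ler_wpM2l L20 (ff' (g' z)); lra.
Qed.

End QuasiIsometryCalculus.

Lemma quasi_isometry_LC_sym (R : realType) (G H : groupType)
    (dG : G -> G -> R) (dH : H -> H -> R) (L C : R) (f : G -> H) :
  quasi_isometry_LC dG dH L C f -> exists f' : H -> G,
    [/\ quasi_isometry_LC dH dG L C f',
        forall x, dG (f' (f x)) x <= C & forall y, dH (f (f' y)) y <= C].
Proof.
by move=> [lf [f' [lf' f'f ff']]]; exists f'; split=> //; split=> //; exists f.
Qed.

Lemma quasi_isometry_LC_mulg (R : realType) (H : groupType) (d : H -> H -> R)
    (h : H) : proper_left_metric d ->
  quasi_isometry_LC d d 1 0 (fun x => h * x)%g.
Proof.
move=> dP; split=> [x y|]; first by rewrite (dist_mulg dP) mul1r addr0.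
exists (fun x => h^-1 * x)%g; split=> [x y|x|x].
- by rewrite (dist_mulg dP) mul1r addr0.
- by rewrite mulKg (dist_refl dP).
- by rewrite mulVKg (dist_refl dP).
Qed.

(** * Coarse stabilizers in a family permuted by quasi-isometries *)

Section CoarseStabilizers.
Variables (R : realType) (H : groupType) (d : H -> H -> R).
Hypothesis dP : proper_left_metric d.
Variable XX : set (set H).

(** The last clause of [qi_characteristic], for arbitrary subsets in place of cosets. *)
Definition qi_permuted : Prop :=
  forall L C : R, 1 <= L -> 0 <= C -> exists M,
    forall f, quasi_isometry_LC d d L C f ->
      (forall X, XX X -> exists Y, XX Y /\ hclose d M (f @` X) Y) /\
      (forall Y, XX Y -> exists X, XX X /\ hclose d M (f @` X) Y).

Definition coarse_stabilizer (X : set H) : set H :=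
  [set h | finite_dist d (lcoset_set h X) X].

Lemma coarse_stabilizer_subgroup X : subgroup (coarse_stabilizer X).
Proof.
apply/subgroupP; split.
  by rewrite /coarse_stabilizer /= lcoset_set1; exists 0; exact: hclose_refl.
move=> g h gX hX; rewrite /coarse_stabilizer /=.
apply: (finite_dist_trans dP) gX.
have := finite_dist_lcoset dP (g * h^-1)%g hX.
by rewrite lcoset_setM mulgVK => /(finite_dist_sym dP).
Qed.

Hypotheses (XXqi : qi_permuted)
  (XXfin : forall y r,
     finite_set [set X | XX X /\ exists x, X x /\ d y x <= r])
  (XX0 : forall X, XX X -> X !=set0)
  (XXD : exists D, forall X Y, XX X -> XX Y ->
     finite_dist d X Y -> hclose d D X Y).

Lemma translates_close : exists M, forall h X, XX X ->
  exists Y, XX Y /\ hclose d M (lcoset_set h X) Y.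
Proof.
have [M MP] := XXqi (lexx 1) (lexx 0); exists M => h X XXX.
by have [/(_ X XXX)] := MP _ (quasi_isometry_LC_mulg h dP).
Qed.

(* Translating [X] so that [y \in X] moves to a fixed [y0 \in X] gives a set
   close to one of the finitely many members of [XX] near [y0]; two points [y]
   leading to the same member differ by an element of the stabilizer. *)
Lemma hclose_coarse_stabilizer X : XX X ->
  exists r, hclose d r (coarse_stabilizer X) X.
Proof.
move=> XXX; have [M MP] := translates_close; have [D DP] := XXD.
have [y0 Xy0] := XX0 XXX.
pose Phi Y r := forall y, X y -> hclose d M (lcoset_set (y0 * y^-1)%g X) Y ->
  exists k, coarse_stabilizer X k /\ d k y <= r.
have [Y r s rs YP y Xy yY|Y _|r rP] :=
    @finite_uniform_bound R _ _ Phi (XXfin y0 M).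
- have [k [Xk ky]] := YP y Xy yY.
  by exists k; split=> //; exact: le_trans rs.
- have [[y' y'Y]|none] :=
      pselect (exists y', hclose d M (lcoset_set (y0 * y'^-1)%g X) Y); last first.
    by exists 0 => y _ yY; case: none; exists y.
  exists (d y'^-1%g 1%g) => y Xy yY; exists (y * y'^-1)%g; split; last first.
    by rewrite -{2}[y]mulg1 (dist_mulg dP).
  (* Both [y0 y^-1 X] and [y0 y'^-1 X] are close to [Y]; translating by [y y0^-1] brings the first
     back to [X] and the second to [y y'^-1 X]. *)
  exists (M + M).
  have := hclose_lcoset dP (y * y0^-1)%g (hclose_trans dP y'Y (hclose_sym dP yY)).
  by rewrite !lcoset_setM !mulgA !mulgVK mulgV lcoset_set1.
(* From [h] in the stabilizer one reaches [h y0] in [h X], then a member of the family within [M],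
   then [X] within [D]; the bound [r] serves the other direction. *)
exists (Num.max (M + D + d 1%g y0) r); split=> [h hX|y Xy].
  have [Y [XXY hY]] := MP h X XXX.
  have YX : finite_dist d Y X.
    by apply: (finite_dist_trans dP) hX; exists M; exact: hclose_sym.
  have [hXX _] := hclose_trans dP hY (DP _ _ XXY XXX YX).
  have [|x [Xx hx]] := hXX (h * y0)%g; first by exists y0.
  exists x; split=> //; rewrite le_max; apply/orP; left.
  apply: le_trans (dist_tri dP (h * y0)%g _ _) _.
  by rewrite addrC lerD // -{1}[h]mulg1 (dist_mulg dP).
have [Y [XXY hY]] := MP (y0 * y^-1)%g X XXX.
have [] := rP Y _ y Xy hY.
  split=> //; have [/(_ y0)[|x]] := hY; last by exists x.
  by exists y => //; rewrite mulgVK.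
by move=> k [Xk ky]; exists k; split=> //; rewrite le_max ky orbT.
Qed.

(** The stabilizer is at finite distance from [X], so an element keeping one within finite distance
    of itself does the same for the other. *)
Lemma commensurator_coarse_stabilizer X : XX X ->
  commensurator (coarse_stabilizer X) `<=` coarse_stabilizer X.
Proof.
move=> XXX g /(commensuratorP dP g (coarse_stabilizer_subgroup X)) gQ.
have [r QX] := hclose_coarse_stabilizer XXX.
apply: (finite_dist_trans dP _) (ex_intro _ r QX).
apply: (finite_dist_trans dP) gQ.
by apply: finite_dist_lcoset => //; exists r; exact: hclose_sym.
Qed.

Lemma exists_subgroups_near : exists (QQ : set (set H)) (r : R),
  [/\ finite_set QQ, forall Q, QQ Q -> subgroup Q,
      forall Q, QQ Q -> finite_index Q (commensurator Q),
      forall X, XX X -> exists B, lcosets_of QQ B /\ hclose d r X B &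
      forall B, lcosets_of QQ B -> exists X, XX X /\ hclose d r X B].
Proof.
have [M MP] := translates_close.
pose E := [set X | XX X /\ exists x, X x /\ d 1%g x <= M].
have [X r s rs|X [XXX _]|r rP] := @finite_uniform_bound R _ _
    (fun X r => hclose d r (coarse_stabilizer X) X) (XXfin 1%g M).
- exact: hclose_le.
- exact: hclose_coarse_stabilizer.
(* [M] is the cost of replacing a translate by a member of the family, [r] that of replacing a
   member of [E] by its stabilizer. *)
exists [set coarse_stabilizer X | X in E], (M + r); split.
- exact/finite_image/XXfin.
- by move=> _ [X _ <-]; exact: coarse_stabilizer_subgroup.
- move=> _ [X [XXX _] <-]; have sQ := coarse_stabilizer_subgroup X.
  split; first exact: sub_commensurator.
  apply: sub_finite_set (finite_set1 (coarse_stabilizer X)).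
  move=> _ [g /(commensurator_coarse_stabilizer XXX) gX <-].
  exact: lcoset_set_id.
- move=> X XXX; have [x Xx] := XX0 XXX.
  have [Y [XXY xY]] := MP x^-1%g X XXX.
  (* The translate [x^-1 X] contains 1, so [Y] has a point within [M] of 1. *)
  have EY : E Y.
    split=> //; have [/(_ 1%g)[|y]] := xY; last by exists y.
    by exists x => //; rewrite mulVg.
  exists (lcoset_set x (coarse_stabilizer Y)); split.
    by exists x, (coarse_stabilizer Y); split=> //; exists Y.
  have := hclose_lcoset dP x (hclose_trans dP xY (hclose_sym dP (rP Y EY))).
  by rewrite lcoset_setM mulgV lcoset_set1.
- move=> _ [h [_ [[Y EY <-] ->]]].
  have [Z [XXZ hZ]] := MP h Y EY.1; exists Z; split=> //.
  apply: hclose_sym => //; rewrite addrC.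
  exact: (hclose_trans dP) (hclose_lcoset dP h (rP Y EY)) hZ.
Qed.

End CoarseStabilizers.

Lemma qi_characteristic_of_near (R : realType) (H : groupType)
    (d : H -> H -> R) (XX QQ : set (set H)) (r : R) :
  proper_left_metric d -> qi_permuted d XX ->
  finite_set QQ -> (forall Q, QQ Q -> subgroup Q) ->
  (forall Q, QQ Q -> finite_index Q (commensurator Q)) ->
  (forall X, XX X -> exists B, lcosets_of QQ B /\ hclose d r X B) ->
  (forall B, lcosets_of QQ B -> exists X, XX X /\ hclose d r X B) ->
  qi_characteristic d QQ.
Proof.
move=> dP XXqi finQQ subQQ commQQ XQ QX; split=> // L C L1 C0.
have L0 : 0 <= L by lra.
have [M MP] := XXqi L C L1 C0.
(* The three legs are [f A] to [f X], [f X] to [Y], and [Y] to [B]. *)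
pose M' := (L * r + C) + (M + r).
exists (Num.max 0 M' + 1); split; first by rewrite ltr_pwDr // le_max lexx.
move=> f qif; have [XY YX] := MP f qif; have [lipf _] := qif.
have near_image A B X Y : hclose d r X A -> hclose d M (f @` X) Y ->
    hclose d r Y B -> (hausdorff_dist d (f @` A) B < (Num.max 0 M' + 1)%:E)%E.
  move=> XA XY' YB; apply: hausdorff_of_hclose.
  apply: (hclose_trans dP) (hclose_trans dP XY' YB).
  exact: hclose_image L0 lipf (hclose_sym dP XA).
split=> // [A QA|B QB].
  have [X [XXX XA]] := QX A QA; have [Y [XXY XY']] := XY X XXX.
  have [B [QB YB]] := XQ Y XXY; exists B; split=> //.
  exact: (near_image _ _ _ _ XA XY' YB).
have [Y [XXY YB]] := QX B QB; have [X [XXX XY']] := YX Y XXY.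
have [A [QA XA]] := XQ X XXX; exists A; split=> //.
exact: (near_image _ _ _ _ XA XY' YB).
Qed.

(** * The images under a quasi-isometry of the cosets in [G] *)

Section ImageFamily.
Variables (R : realType) (G H : groupType).
Variables (dG : G -> G -> R) (dH : H -> H -> R).
Hypotheses (dGP : proper_left_metric dG) (dHP : proper_left_metric dH).
Variables (PP : set (set G)) (L C : R) (q : G -> H) (q' : H -> G).
Hypotheses (subPP : forall P, PP P -> subgroup P)
  (charPP : qi_characteristic dG PP) (L1 : 1 <= L) (C0 : 0 <= C)
  (qi_q : quasi_isometry_LC dG dH L C q)
  (qi_q' : quasi_isometry_LC dH dG L C q')
  (q'q : forall x, dG (q' (q x)) x <= C) (qq' : forall y, dH (q (q' y)) y <= C).

Let XX : set (set H) := [set q @` A | A in lcosets_of PP].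

Let L0 : 0 <= L. Proof. exact: le_trans ler01 L1. Qed.

(** The hypothesis on [PP] applies to [q' f q]; pushing the result forward by [q] recovers [f] on
    images, as [q q'] moves points by at most [C]. *)
Lemma image_family_qi_permuted : qi_permuted dH XX.
Proof.
have [_ _ char] := charPP.
move=> L' C' L'1 C'0.
(* [C1] and [C2] are the constants [quasi_isometry_LC_comp] yields for [f q] and for [q' f q]. *)
pose C1 := L * C' + L' * C + 2 * C + 2 * C'.
pose C2 := L * L' * C + L * C1 + 2 * C1 + 2 * C.
have L'0 : 0 <= L' by lra.
have LL'1 : 1 <= L * L' by rewrite -[1]mulr1 ler_pM.
have C10 : 0 <= C1 by rewrite /C1 !addr_ge0 // mulr_ge0.
have C20 : 0 <= C2 by rewrite /C2 !addr_ge0 // !mulr_ge0.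
have LL'L1 : 1 <= L * L' * L by rewrite -[1]mulr1 ler_pM.
have [M [M0 MP]] := char _ _ LL'L1 C20.
exists (C + (L * M + C)) => f qif.
have qi_fq := quasi_isometry_LC_comp dGP dHP L1 C0 L'1 C'0 qi_q qif.
have qi_q'fq := quasi_isometry_LC_comp dGP dGP LL'1 C10 L1 C0 qi_fq qi_q'.
have [_ AB BA] := MP _ qi_q'fq.
have transfer A B :
    (hausdorff_dist dG ((q' \o (f \o q)) @` A) B < M%:E)%E ->
    hclose dH (C + (L * M + C)) (f @` (q @` A)) (q @` B).
  move=> /hclose_of_hausdorff/(hclose_image L0 qi_q.1); apply: hclose_trans => //.
  have -> : q @` ((q' \o (f \o q)) @` A) = (q \o q') @` (f @` (q @` A)).
    by rewrite !image_comp.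
  by apply: hclose_sym => //; exact: hclose_displacement.
split=> _ [A PA <-].
  by have [B [PB /transfer AB']] := AB A PA; exists (q @` B); split=> //; exists B.
by have [B [PB /transfer AB']] := BA A PA; exists (q @` B); split=> //; exists B.
Qed.

(** A coset whose image meets the ball has a point within [L * r + C + C] of [q' y], and it is
    determined by this point and its subgroup. *)
Lemma image_family_finite y r :
  finite_set [set X | XX X /\ exists x, X x /\ dH y x <= r].
Proof.
have [finPP _ _] := charPP.
have fin := finite_image2 (@lcoset_set G)
  (finite_ball dGP (q' y) (L * r + C + C)) finPP.
apply: (sub_finite_set _ (finite_image (fun A => q @` A) fin)).
move=> _ [[_ [g [P [PPP ->]]] <-] [_ [[a [p Pp <-] <-] ya]]].
exists (lcoset_set g P) => //; exists (g * p)%g.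
  apply: le_trans (dist_tri dGP (q' (q (g * p)%g)) _ _) (lerD _ (q'q _)).
  by apply: le_trans (qi_q'.1 _ _) _; rewrite lerD2r ler_wpM2l.
by exists P => //; rewrite -lcoset_setM (lcoset_set_id (subPP PPP) Pp).
Qed.

(** Finite distance pulls back to the cosets through [q']; their uniform bound is pushed forward by
    [q]. *)
Lemma image_family_bounded : exists D, forall X Y, XX X -> XX Y ->
  finite_dist dH X Y -> hclose dH D X Y.
Proof.
have [finPP commPP _] := charPP.
have [D DP] := finite_dist_bounded dGP finPP subPP commPP.
exists (L * D + C) => _ _ [A PA <-] [B PB <-] [r /(hclose_image L0 qi_q'.1) AB].
apply: hclose_image L0 qi_q.1 _; apply: DP => //.
have near A' : hclose dG C (q' @` (q @` A')) A'.
  by rewrite image_comp; exact: hclose_displacement.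
exists (C + ((L * r + C) + C)).
exact: (hclose_trans dGP) (hclose_sym dGP (near A))
  (hclose_trans dGP AB (near B)).
Qed.

Lemma image_family_nonempty X : XX X -> X !=set0.
Proof.
move=> [A PA <-]; have [x Ax] := lcosets_of_nonempty subPP PA.
by exists (q x); exists x.
Qed.

End ImageFamily.

Theorem theorem1p1 (R : realType) (G H : groupType)
  (S : set G) (finS : finite_set S) (genS : generates S)
  (T : set H) (finT : finite_set T) (genT : generates T)
  (PP : set (set G)) (subPP : forall P, PP P -> subgroup P)
  (finPP : finite_set PP)
  (charPP : qi_characteristic (word_dist R S) PP)
  (q : G -> H) (qi_q : quasi_isometry (word_dist R S) (word_dist R T) q) :
  exists QQ : set (set H),
    [/\ forall Q, QQ Q -> subgroup Q,
        qi_characteristic (word_dist R T) QQ &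
        quasi_isometry_pairs (word_dist R S) (word_dist R T) PP QQ q].
Proof.
have dGP := word_dist_proper R finS genS.
have dHP := word_dist_proper R finT genT.
have [L [C [L1 C0 qiq]]] := qi_q.
have [q' [qiq' q'q qq']] := quasi_isometry_LC_sym qiq.
have XXqi := image_family_qi_permuted dGP dHP charPP L1 C0 qiq qiq' qq'.
have [QQ [r [finQQ subQQ commQQ XQ QX]]] := exists_subgroups_near dHP XXqi
  (image_family_finite dGP subPP charPP L1 qiq' q'q)
  (image_family_nonempty (q := q) subPP)
  (image_family_bounded dGP subPP charPP L1 qiq qiq' q'q).
exists QQ; split=> //; first exact: qi_characteristic_of_near dHP XXqi _ _ _ XQ QX.
exists L, C, (Num.max 0 r + 1); split=> //.
  by rewrite ltr_pwDr // le_max lexx.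
(* Members of the family are exactly the sets [q A], so its closeness to cosets of [QQ] is the pair
   condition for [q]. *)
split=> // [A PA|B /QX[_ [[A PA <-] AB]]]; last first.
  by exists A; split=> //; exact: hausdorff_of_hclose.
have [|B [QB AB]] := XQ (q @` A); first by exists A.
by exists B; split=> //; exact: hausdorff_of_hclose.
Qed.
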